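(* Let $X$ be a non-empty set. For all $x,u,v\in X$ the following equalities of equivalence classes of trees in $\mathcal T(X)$ hold: $$\Delta^x_\varepsilon(u,v)=\Sigma_\varepsilon^{\circ(x,u)}\big(\mathrm{inv}^x_\varepsilon(u),v\big),\qquad \mathrm{inv}^x_\varepsilon(u)=\Delta^x_\varepsilon(u,x),\qquad \mathrm{inv}_\varepsilon^{\circ(x,u)}\big(\mathrm{inv}^x_\varepsilon(u)\big)=u.$$
   Context: **Trees.** Consider planar binary trees with leaves in $X$ and each node decorated with one of two colours $\circ,\bullet$. For trees $P,Q$ write $\circ(P,Q)$ (resp. $\bullet(P,Q)$) for the tree whose root is a node coloured $\circ$ (resp. $\bullet$) with left subtree $P$ and right subtree $Q$; each $x\in X$ is identified with the tree having no nodes and single leaf $x$. ($\circ(x,u)$ codes the dilatation $\delta^x_\varepsilon u$, and $\bullet$ codes dilatation of coefficient $\varepsilon^{-1}$.) $\mathcal T(X)$ is the smallest class of such trees, containing $X$ (and the empty tree), with an equivalence relation $\approx$, such that: - T0: for $x,u,v\in X$ the trees $\circ(x,u)$, $\bullet(\circ(x,u),\circ(x,v))$, $\bullet(\circ(x,u),x)$, $\bullet(x,\circ(\circ(x,u),v))$ belong to $\mathcal T(X)$, and $\mathcal T(X)$ is closed under grafting (replacing a leaf of a tree by a tree); - T1: at any place inside a tree, a subtree $\bullet(Z,\circ(Z,Q))$ or $\circ(Z,\bullet(Z,Q))$ ($Z,Q$ trees) may be replaced by $Q$, and conversely, giving an equivalent tree; if the reduced tree is in $\mathcal T(X)$, so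 is the unreduced one; - T2: for $x\in X$, a subtree $\circ(x,x)$ or $\bullet(x,x)$ may be replaced by the leaf $x$, and conversely, giving an equivalent tree; these trees belong to $\mathcal T(X)$. Two trees are equivalent if and only if one is obtained from the other by finitely many applications of T1, T2. Equality of expressions below means equality of equivalence classes. **Operations.** For trees $Z,P,Q$: $\Delta^Z_\varepsilon(P,Q)$ is the class of $\bullet(\circ(Z,P),\circ(Z,Q))$; $\Sigma^Z_\varepsilon(P,Q)$ is the class of $\bullet(Z,\circ(\circ(Z,P),Q))$; $\mathrm{inv}^Z_\varepsilon(P)$ is the class of $\bullet(\circ(Z,P),Z)$. *)

(* Defs.v *)
From Stdlib Require Import Relations.Relation_Operators.
From mathcomp Require Import all_boot classical_sets.

Set Implicit Arguments.
Unset Strict Implicit.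
Unset Printing Implicit Defensive.

Local Open Scope classical_set_scope.

Inductive color := White | Black.

Inductive btree (X : Type) : Type :=
  | leaf of X
  | node of color & btree X & btree X.

(* [btree] has no empty member, so that an internal node always has two
   genuine subtrees; the empty tree is added on top. *)
Inductive ptree (X : Type) : Type :=
  | empty_tree
  | tree_of of btree X.
Arguments empty_tree {X}.
Coercion tree_of : btree >-> ptree.

Notation "∘( P , Q )" := (node White P Q) (at level 0, format "∘( P ,  Q )").
Notation "•( P , Q )" := (node Black P Q) (at level 0, format "•( P ,  Q )").

(* [at_place R P Q]: Q is P with exactly one occurrence of a subtree A
   replaced by some B such that [R A B]. *)
Inductive at_place (X : Type) (R : btree X -> btree X -> Prop) :
    btree X -> btree X -> Prop :=
  | at_root A B : R A B -> at_place R A B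
  | at_left c A B Q : at_place R A B -> at_place R (node c A Q) (node c B Q)
  | at_right c P A B : at_place R A B -> at_place R (node c P A) (node c P B).

Inductive reduceT1 (X : Type) : btree X -> btree X -> Prop :=
  | reduce_bw (Z Q : btree X) : reduceT1 •(Z, ∘(Z, Q)) Q
  | reduce_wb (Z Q : btree X) : reduceT1 ∘(Z, •(Z, Q)) Q.

Inductive reduceT2 (X : Type) : btree X -> btree X -> Prop :=
  | reduce_w (x : X) : reduceT2 ∘(leaf x, leaf x) (leaf x)
  | reduce_b (x : X) : reduceT2 •(leaf x, leaf x) (leaf x).

Inductive leaf_to (X : Type) (G : btree X) : btree X -> btree X -> Prop :=
  | Leaf_to (x : X) : leaf_to G (leaf x) G.

(* Membership in the class T(X), closed under grafting at one leaf occurrence;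
   in T1 the trees Z, Q are arbitrary non-empty trees. *)
Inductive inT (X : Type) : ptree X -> Prop :=
  | inT_empty : inT empty_tree
  | inT_leaf (x : X) : inT (leaf x)
  | inT_dil (x u : X) : inT ∘(leaf x, leaf u)
  | inT_delta (x u v : X) :
      inT •(∘(leaf x, leaf u), ∘(leaf x, leaf v))
  | inT_inv (x u : X) : inT •(∘(leaf x, leaf u), leaf x)
  | inT_sigma (x u v : X) :
      inT •(leaf x, ∘(∘(leaf x, leaf u), leaf v))
  | inT_graft (P G Q : btree X) :
      inT P -> inT G -> at_place (leaf_to G) P Q -> inT Q
  | inT_T1 (P Q : btree X) : at_place (@reduceT1 X) P Q -> inT Q -> inT P
  | inT_T2w (x : X) : inT ∘(leaf x, leaf x)
  | inT_T2b (x : X) : inT •(leaf x, leaf x).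

(* One reduction by T1 or T2, both trees being in T(X); the converse
   replacements come from the symmetric closure in [eqT]. *)
Inductive stepT (X : Type) : ptree X -> ptree X -> Prop :=
  | StepT1 (P Q : btree X) :
      inT P -> inT Q -> at_place (@reduceT1 X) P Q -> stepT P Q
  | StepT2 (P Q : btree X) :
      inT P -> inT Q -> at_place (@reduceT2 X) P Q -> stepT P Q.

Definition eqT (X : Type) : ptree X -> ptree X -> Prop :=
  clos_refl_sym_trans (ptree X) (@stepT X).

Definition classT (X : Type) (P : ptree X) : set (ptree X) :=
  [set Q | inT Q /\ eqT P Q].

(* Equality of the expressions P and Q: both denote trees of T(X), and their
   equivalence classes in T(X) coincide. *)
Definition same_class (X : Type) (P Q : ptree X) : Prop :=
  [/\ inT P, inT Q & classT P = classT Q].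

Notation "P ≡ Q" := (same_class P Q) (at level 70, no associativity).

(* The three operations, given by the trees whose classes they denote, so that
   they can be nested; they are always compared through [same_class]. The
   parameter epsilon is purely formal: it is coded by the two colours. *)
Definition Delta (X : Type) (Z P Q : btree X) : btree X :=
  •(∘(Z, P), ∘(Z, Q)).

Definition Sigma (X : Type) (Z P Q : btree X) : btree X :=
  •(Z, ∘(∘(Z, P), Q)).

Definition inv (X : Type) (Z P : btree X) : btree X :=
  •(∘(Z, P), Z).

(* Main.v *)
Require Import Defs.
From Stdlib Require Import Relations.Relation_Operators.
From mathcomp Require Import ssreflect ssrfun ssrbool classical_sets.

Set Implicit Arguments.
Unset Strict Implicit.
Unset Printing Implicit Defensive.

(** Once the operations are unfolded, everything rests on one cancellation: with [Z] = [∘(x, u)],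
    the tree [inv x u] is [•(Z, x)], so T1 collapses [∘(Z, inv x u)] to [x]. This settles the first
    equality and starts the third; the second is one use of T2. *)

Lemma eqT_same_class (X : Type) (P Q : ptree X) :
  inT P -> inT Q -> eqT P Q -> P ≡ Q.
Proof.
move=> inP inQ PQ; split=> //; apply/seteqP; split=> R [inR eqR]; split=> //.
  exact: rst_trans (rst_sym _ _ _ _ PQ) eqR.
exact: rst_trans PQ eqR.
Qed.

Lemma same_class_sym (X : Type) (P Q : ptree X) : P ≡ Q -> Q ≡ P.
Proof. by case=> inP inQ PQ; split. Qed.

Lemma same_class_trans (X : Type) (P Q R : ptree X) : P ≡ Q -> Q ≡ R -> P ≡ R.
Proof. by case=> inP _ PQ [_ inR QR]; split=> //; rewrite PQ. Qed.

(** Membership climbs from the reduced tree to the unreduced one by [inT_T1], so the large nested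
    trees need no grafting argument. *)
Lemma same_class_T1 (X : Type) (P Q : btree X) :
  at_place (@reduceT1 X) P Q -> inT Q -> P ≡ Q.
Proof.
move=> PQ inQ; have inP := inT_T1 PQ inQ.
by apply: eqT_same_class => //; apply/rst_step/StepT1.
Qed.

Lemma same_class_T2 (X : Type) (P Q : btree X) :
  at_place (@reduceT2 X) P Q -> inT P -> inT Q -> P ≡ Q.
Proof. by move=> PQ inP inQ; apply: eqT_same_class => //; apply/rst_step/StepT2. Qed.

Theorem proposition4 (X : Type) (hX : inhabited X) (x u v : X) :
  Delta (leaf x) (leaf u) (leaf v)
    ≡ Sigma ∘(leaf x, leaf u) (inv (leaf x) (leaf u)) (leaf v)
  /\ inv (leaf x) (leaf u) ≡ Delta (leaf x) (leaf u) (leaf x)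
  /\ inv ∘(leaf x, leaf u) (inv (leaf x) (leaf u)) ≡ leaf u.
Proof.
split; last split.
- apply/same_class_sym/same_class_T1; last exact: inT_delta.
  by apply/at_right/at_left/at_root/reduce_wb.
- apply/same_class_sym/same_class_T2; [|exact: inT_delta|exact: inT_inv].
  (* [Delta x u x] ends in [∘(x, x)], which T2 contracts to [x]. *)
  by apply/at_right/at_root/reduce_w.
- have red : •(leaf x, ∘(leaf x, leaf u)) ≡ leaf u.
    by apply: same_class_T1; [apply/at_root/reduce_bw|exact: inT_leaf].
  (* Cancelling at base [∘(x, u)] leaves [•(x, ∘(x, u))], a second T1 redex, now at base [x]. *)
  apply: same_class_trans (red); apply: same_class_T1; last by case: red.
  by apply/at_left/at_root/reduce_wb.
Qed.
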